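(* Let $(X,\tau)$ be a sober topological space. Then the Munn semigroup $T_{\Omega(X)}$ of the semilattice $\Omega(X)$ of open sets of $X$ is isomorphic to the inverse semigroup $\mathcal{I}(X,\tau)$ of all homeomorphisms between open subsets of $X$.
   Context: $\Omega(X)$ is the frame of open subsets of $X$, regarded as a meet-semilattice under intersection. For a meet-semilattice $E$, the Munn semigroup $T_E$ is the inverse semigroup of all order-isomorphisms between principal order-ideals $e^{\downarrow}=\{f\in E: f\le e\}$ of $E$, under composition of partial bijections. $\mathcal{I}(X,\tau)$ is the inverse semigroup of all homeomorphisms between open subsets of $X$ under composition of partial bijections. A space $X$ is sober if every completely prime filter in $\Omega(X)$ is the neighbourhood filter of a unique point of $X$. *)

(* Defs.v *)
From HB Require Import structures.
From mathcomp Require Import all_boot all_order.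
From mathcomp Require Import all_classical.
From mathcomp Require Import topology.

Set Implicit Arguments.
Unset Strict Implicit.
Unset Printing Implicit Defensive.

Import Order.TTheory.
Local Open Scope classical_set_scope.
Local Open Scope group_scope.

HB.mixin Record Semigroup_isInverseSemigroup S & Semigroup S := {
  sginv : S -> S;
  sgmulVK : forall x : S, x * sginv x * x = x;
  sgVmulK : forall x : S, sginv x * x * sginv x = sginv x;
  sginv_uniq : forall x y : S, x * y * x = x -> y * x * y = y -> y = sginv x
}.

#[short(type="inverseSemigroupType")]
HB.structure Definition InverseSemigroup :=
  {S of Semigroup_isInverseSemigroup S & Semigroup S}.

(* A partial bijection of T (a bijection between two subsets of T) is stored
   as a partial function together with its partial inverse; the latter is
   determined by the former, see pbij_ext. *)
Record pbij (T : Type) := PBij {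
  pfun :> T -> option T;
  pfunV : T -> option T;
  pfunP : forall x y, pfun x = Some y <-> pfunV y = Some x
}.

Lemma pbij_ext T (f g : pbij T) : (forall x, f x = g x) -> f = g.
Proof.
case: f g => [f f' fP] [g g' gP] /= fg.
have {}fg : f = g by apply/funext.
subst g; have ff' : f' = g'.
  apply/funext => y; case Ef: (f' y) => [x|].
    by apply/esym/gP/fP.
  by case Eg: (g' y) => [x|//]; move/gP/fP: Eg; rewrite Ef.
by subst g'; congr PBij; exact: Prop_irrelevance.
Qed.

HB.instance Definition _ T := gen_eqMixin (pbij T).
HB.instance Definition _ T := gen_choiceMixin (pbij T).

Section PartialBijections.
Context {T : Type}.
Implicit Types f g h : pbij T.

Definition pdom f : set T := [set x | f x].

Definition pbij_inv f : pbij T :=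
  PBij (fun y x => iff_sym (pfunP f x y)).

Definition pran f : set T := pdom (pbij_inv f).

Fact pbij_mul_subproof f g x z :
  obind f (g x) = Some z <-> obind (pfunV g) (pfunV f z) = Some x.
Proof.
split.
  case E: (g x) => [y|//] /= /pfunP ->.
  exact/pfunP.
case E: (pfunV f z) => [y|//] /= /pfunP ->.
exact/pfunP.
Qed.

(* (f * g) x = f (g x), defined when g x is defined and lies in the domain of
   f *)
Definition pbij_mul f g : pbij T := PBij (@pbij_mul_subproof f g).

Lemma pbij_mulA : associative pbij_mul.
Proof. by move=> f g h; apply: pbij_ext => x /=; case: (h x). Qed.

HB.instance Definition _ := isSemigroup.Build (pbij T) pbij_mulA.

Lemma pbij_mulE f g x : (f * g) x = obind f (g x).
Proof. by []. Qed.

Lemma pbij_mulVK f : f * pbij_inv f * f = f.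
Proof.
apply: pbij_ext => x; rewrite !pbij_mulE.
by case E: (f x) => [y|//] /=; have /pfunP -> := E.
Qed.

Lemma pbij_invK : involutive pbij_inv.
Proof. by move=> f; exact: pbij_ext. Qed.

Lemma pbij_VmulK f : pbij_inv f * f * pbij_inv f = pbij_inv f.
Proof. by rewrite -{2}(pbij_invK f) pbij_mulVK. Qed.

Lemma pbij_invM f g : pbij_inv (f * g) = pbij_inv g * pbij_inv f.
Proof. exact: pbij_ext. Qed.

Lemma pbij_inv_sub f g y x : f * g * f = f -> f x = Some y -> g y = Some x.
Proof.
move=> fgf fx; have := congr1 (fun k : pbij T => k x) fgf.
rewrite !pbij_mulE fx /=.
by case: (g y) => [z|//] /= /pfunP; have /pfunP -> := fx => -[->].
Qed.

Lemma pbij_inv_uniq f g : f * g * f = f -> g * f * g = g -> g = pbij_inv f.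
Proof.
move=> fgf gfg; apply: pbij_ext => y /=.
case E: (pfunV f y) => [x|].
  by apply: pbij_inv_sub fgf _; apply/pfunP.
case Eg: (g y) => [x|//].
by have /pfunP := pbij_inv_sub gfg Eg; rewrite E.
Qed.

HB.instance Definition _ := Semigroup_isInverseSemigroup.Build (pbij T)
  pbij_mulVK pbij_VmulK pbij_inv_uniq.

Lemma pdomP f x : pdom f x <-> exists y, f x = Some y.
Proof.
rewrite /pdom/=; split=> [|[y ->]//].
by case: (f x) => [y|//] _; exists y.
Qed.

Lemma pranP f y : pran f y <-> exists x, f x = Some y.
Proof.
split=> [/pdomP[x fx]|[x fx]]; first by exists x; exact/pfunP.
by apply/pdomP; exists x; exact/pfunP.
Qed.

End PartialBijections.

Section Munn.
Context d (E : meetSemilatticeType d).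
Implicit Types (e f x y : E) (a b : pbij E).

Definition pideal e : set E := [set f | (f <= e)%O].

Definition is_munn a :=
  exists e f, [/\ pdom a = pideal e, pran a = pideal f &
    forall x y x' y', a x = Some x' -> a y = Some y' ->
      (x <= y)%O = (x' <= y')%O].

Lemma is_munnV a : is_munn a -> is_munn (pbij_inv a).
Proof.
move=> [e [f [De Df mono]]]; exists f, e; split; first exact: Df.
  by rewrite /pran pbij_invK.
move=> x y x' y' /pfunP ax /pfunP ay; exact/esym/mono.
Qed.

Lemma munn_dom_mul a b : is_munn a -> is_munn b ->
  exists e, pdom (a * b) = pideal e.
Proof.
move=> [e [f [Da _ _]]] [h [k [Db Rb bmono]]].
have /pranP[m bm] : pran b (e `&` k)%O by rewrite Rb /pideal/= leIr.
have bD x y : b x = Some y -> (y <= k)%O.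
  move=> bx; have Ry : pran b y by apply/pranP; exists x.
  by rewrite Rb in Ry.
exists m; apply/seteqP; split => x /=.
  rewrite /pdom/=; case bx: (b x) => [y|//] /= ay.
  have : pdom a y by [].
  by rewrite Da /pideal/= (bmono _ _ _ _ bx bm) lexI => ->; rewrite (bD _ _ bx).
rewrite /pideal/= => xm.
have /pdomP[y bx] : pdom b x.
  have Dm : pdom b m by rewrite /pdom/= bm.
  by rewrite Db in Dm *; exact: le_trans xm Dm.
rewrite /pdom/= bx/=.
suff : pdom a y by [].
rewrite Da /pideal/=.
by move: xm; rewrite (bmono _ _ _ _ bx bm) lexI => /andP[].
Qed.

Lemma is_munnM a b : is_munn a -> is_munn b -> is_munn (a * b).
Proof.
move=> Ma Mb; have [e De] := munn_dom_mul Ma Mb.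
have [f Df] := munn_dom_mul (is_munnV Mb) (is_munnV Ma).
exists e, f; split; [exact: De | by rewrite /pran pbij_invM | ].
move: Ma Mb => [_ [_ [_ _ amono]]] [_ [_ [_ _ bmono]]] x y x' y'.
rewrite !pbij_mulE.
case bx: (b x) => [u|//]; case by_: (b y) => [v|//] /= au av.
by rewrite (bmono _ _ _ _ bx by_) (amono _ _ _ _ au av).
Qed.

Record munn := Munn { munn_val :> pbij E; munnP : `[< is_munn munn_val >] }.

HB.instance Definition _ := [isSub for munn_val].
HB.instance Definition _ := [Choice of munn by <:].

Fact munn_mul_closed : mulg_closed (fun a => `[< is_munn a >]).
Proof. by move=> a b /asboolP Ma /asboolP Mb; exact/asboolP/is_munnM. Qed.

HB.instance Definition _ :=
  SubChoice_isSubSemigroup.Build _ _ munn munn_mul_closed.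

Definition munn_inv (a : munn) : munn :=
  Munn (introT (asboolP _) (is_munnV (elimT (asboolP _) (munnP a)))).

Fact munn_mulVK (a : munn) : a * munn_inv a * a = a.
Proof. by apply: val_inj; rewrite !valM; exact: sgmulVK. Qed.

Fact munn_VmulK (a : munn) : munn_inv a * a * munn_inv a = munn_inv a.
Proof. by apply: val_inj; rewrite !valM; exact: sgVmulK. Qed.

Fact munn_inv_uniq (a b : munn) :
  a * b * a = a -> b * a * b = b -> b = munn_inv a.
Proof.
move=> /(congr1 val) + /(congr1 val); rewrite !valM => aba bab.
by apply: val_inj; exact: pbij_inv_uniq.
Qed.

HB.instance Definition _ := Semigroup_isInverseSemigroup.Build munn
  munn_mulVK munn_VmulK munn_inv_uniq.

End Munn.

Section PartialHomeomorphisms.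
Context (X : topologicalType).
Implicit Types f g : pbij X.

(* The values outside pdom f are irrelevant for {within pdom f, continuous _};
   the identity makes this meaningful for the empty space as well. *)
Definition ptotal f (x : X) : X := odflt x (f x).

Definition is_homeo f :=
  [/\ open (pdom f), open (pran f),
      {within pdom f, continuous (ptotal f)} &
      {within pran f, continuous (ptotal (pbij_inv f))}].

Lemma within_ptotalP f : open (pdom f) ->
  {within pdom f, continuous (ptotal f)} <->
  (forall W : set X, open W -> open [set x | exists2 y, f x = Some y & W y]).
Proof.
move=> oD; rewrite continuous_open_subspace // continuous_inP //.
have E W : pdom f `&` ptotal f @^-1` W =
    [set x | exists2 y, f x = Some y & W y].
  rewrite /pdom /ptotal; apply/seteqP; split => x /=; last first.
    by move=> [y -> Wy].
  by case: (f x) => [y [_ Wy]|[]//]; exists y.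
by split=> h W /h; rewrite E.
Qed.

Lemma is_homeoV f : is_homeo f -> is_homeo (pbij_inv f).
Proof. by case=> ? ? ? ?; split; rewrite // /pran pbij_invK. Qed.

Lemma homeo_dom_mul f g : is_homeo f -> is_homeo g ->
  open (pdom (f * g)) /\ {within pdom (f * g), continuous (ptotal (f * g))}.
Proof.
move=> [oDf _ cf _] [oDg _ cg _].
have oD : open (pdom (f * g)).
  have := (within_ptotalP oDg).1 cg _ oDf.
  congr open; apply/seteqP; split => x /=; rewrite /pdom/=.
    by move=> [y -> fy].
  by case: (g x) => [y|//] fy; exists y.
split=> //; apply/within_ptotalP => // W oW.
have := (within_ptotalP oDg).1 cg _ ((within_ptotalP oDf).1 cf _ oW).
congr open; apply/seteqP; split => x /=.
  by move=> [y gx [z fy Wz]]; exists z => //; rewrite /= gx.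
move=> [z]; case: (g x) => [y|//] /= fy Wz.
by exists y => //; exists z.
Qed.

Lemma is_homeoM f g : is_homeo f -> is_homeo g -> is_homeo (f * g).
Proof.
move=> Hf Hg; have [oD cD] := homeo_dom_mul Hf Hg.
have [oR cR] := homeo_dom_mul (is_homeoV Hg) (is_homeoV Hf).
by split=> //; rewrite /pran pbij_invM.
Qed.

Record phomeo := PHomeo {
  phomeo_val :> pbij X; phomeoP : `[< is_homeo phomeo_val >] }.

HB.instance Definition _ := [isSub for phomeo_val].
HB.instance Definition _ := [Choice of phomeo by <:].

Fact phomeo_mul_closed : mulg_closed (fun f => `[< is_homeo f >]).
Proof. by move=> f g /asboolP Hf /asboolP Hg; exact/asboolP/is_homeoM. Qed.

HB.instance Definition _ :=
  SubChoice_isSubSemigroup.Build _ _ phomeo phomeo_mul_closed.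

Definition phomeo_inv (f : phomeo) : phomeo :=
  PHomeo (introT (asboolP _) (is_homeoV (elimT (asboolP _) (phomeoP f)))).

Fact phomeo_mulVK (f : phomeo) : f * phomeo_inv f * f = f.
Proof. by apply: val_inj; rewrite !valM; exact: sgmulVK. Qed.

Fact phomeo_VmulK (f : phomeo) : phomeo_inv f * f * phomeo_inv f = phomeo_inv f.
Proof. by apply: val_inj; rewrite !valM; exact: sgVmulK. Qed.

Fact phomeo_inv_uniq (f g : phomeo) :
  f * g * f = f -> g * f * g = g -> g = phomeo_inv f.
Proof.
move=> /(congr1 val) + /(congr1 val); rewrite !valM => fgf gfg.
by apply: val_inj; exact: pbij_inv_uniq.
Qed.

HB.instance Definition _ := Semigroup_isInverseSemigroup.Build phomeo
  phomeo_mulVK phomeo_VmulK phomeo_inv_uniq.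

End PartialHomeomorphisms.

Section Opens.
Context (X : topologicalType).

Record opens := Opens {
  opens_val :> set X; opensP : opens_val \in (open : set (set X)) }.

HB.instance Definition _ := [isSub for opens_val].
HB.instance Definition _ := [Choice of opens by <:].

Local Notation openp := (fun U : set X => U \in (open : set (set X))).

Fact opens_meet_closed : {in openp &, forall U V : set X, openp (U `&` V)%O}.
Proof. by move=> U V /set_mem oU /set_mem oV; exact/mem_set/openI. Qed.

Fact opens_join_closed : {in openp &, forall U V : set X, openp (U `|` V)%O}.
Proof. by move=> U V /set_mem oU /set_mem oV; exact/mem_set/openU. Qed.

Fact opens_bot : openp (\bot%O : set X).
Proof. exact/mem_set/open0. Qed.

Fact opens_top : openp (\top%O : set X).
Proof. exact/mem_set/openT. Qed.

(* inclusion order: the meet of opens is intersection, the join is union *)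
HB.instance Definition _ := Order.SubChoice_isTBSubLattice.Build
  set_display (set X) openp set_display opens
  opens_meet_closed opens_join_closed opens_bot opens_top.

Fact opens_bigcup_subproof (G : set opens) :
  (\bigcup_(U in G) (U : set X)) \in (open : set (set X)).
Proof. by apply/mem_set/bigcup_open => U _; exact/set_mem/opensP. Qed.

Definition opens_bigcup (G : set opens) : opens :=
  Opens (opens_bigcup_subproof G).

Record completely_prime_filter (F : set opens) : Prop := {
  cpf_top : F \top%O;
  cpf_meet : forall U V, F U -> F V -> F (U `&` V)%O;
  cpf_up : forall U V, (U <= V)%O -> F U -> F V;
  cpf_prime : forall G : set opens, F (opens_bigcup G) -> exists2 U, G U & F U
}.

Definition nbhd_filter (x : X) : set opens :=
  [set U | open_nbhs x (U : set X)].

Definition sober :=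
  forall F : set opens, completely_prime_filter F ->
    exists! x : X, F = nbhd_filter x.

End Opens.

(* Main.v *)
Require Import Defs.
From HB Require Import structures.
From mathcomp Require Import all_boot all_order.
From mathcomp Require Import all_classical.
From mathcomp Require Import topology.

(** A homeomorphism f between open sets acts on the open subsets of its domain
    by direct image, and this action is multiplicative in f.  Sobriety makes it
    injective, because points with the same neighbourhoods coincide, and
    surjective: if a is an isomorphism from the opens below e onto the opens
    below h, then for x in e the opens lying above some a W with x in W form a
    completely prime filter, and its point is the image of x under the
    homeomorphism inducing a. *)

Set Implicit Arguments.
Unset Strict Implicit.
Unset Printing Implicit Defensive.

Import Order.TTheory.
Local Open Scope classical_set_scope.
Local Open Scope group_scope.

(** * Partial bijections described by their graphs *)

Lemma pbij_eqP T (f g : pbij T) :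
  (forall x y, f x = Some y <-> g x = Some y) -> f = g.
Proof.
move=> fg; apply: pbij_ext => x; case fx: (f x) => [y|].
  by apply/esym/fg.
by case gx: (g x) => [y|//]; move/fg: gx; rewrite fx.
Qed.

Lemma pbij_invP T (f : pbij T) x y : pbij_inv f y = Some x <-> f x = Some y.
Proof. by split=> /pfunP. Qed.

Lemma pbij_inj T (f : pbij T) x x' y : f x = Some y -> f x' = Some y -> x = x'.
Proof. by move=> /pbij_invP + /pbij_invP => -> -[]. Qed.

(** Excluded middle and choice turn [R] and its converse into partial functions. Both the action on
    opens and the homeomorphism induced by [a] are built this way. *)
Lemma pbij_of_rel T (R : T -> T -> Prop) :
  (forall x y y', R x y -> R x y' -> y = y') ->
  (forall x x' y, R x y -> R x' y -> x = x') ->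
  exists f : pbij T, forall x y, f x = Some y <-> R x y.
Proof.
have graph (Q : T -> T -> Prop) : (forall x y y', Q x y -> Q x y' -> y = y') ->
    exists q : T -> option T, forall x y, q x = Some y <-> Q x y.
  move=> Qfun.
  suff /choice[q qP] : forall x, exists o, forall y, o = Some y <-> Q x y.
    by exists q.
  move=> x; have [[y Qxy]|nQ] := pselect (exists y, Q x y).
    by exists (Some y) => z; split=> [[<-]//|/(Qfun _ _ _ Qxy) ->].
  by exists None => z; split=> // Qxz; case: nQ; exists z.
move=> Rfun Rinj; have [q qP] := graph _ Rfun.
have [r rP] := graph (fun y x => R x y) (fun y x x' => Rinj x x' y).
by exists (PBij (fun x y => iff_trans (qP x y) (iff_sym (rP y x)))).
Qed.

(** * The direct image action of a homeomorphism on open sets *)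

Section Image.
Context {X : topologicalType}.
Implicit Types (f g : phomeo X) (W V : set X).

Lemma leopensP (U V : opens X) : (U <= V)%O <-> (U : set X) `<=` V.
Proof. by rewrite -subsetEset; split=> ?. Qed.

Lemma opens_inj (U V : opens X) : (U : set X) = V -> U = V.
Proof. by move=> UV; exact: val_inj. Qed.

Lemma open_opens (U : opens X) : open (U : set X).
Proof. exact/set_mem/opensP. Qed.

Definition mkopens V (oV : open V) : opens X := Opens (mem_set oV).

(** The form of the preimage in which [within_ptotalP] expresses continuity. *)
Definition preim (f : pbij X) V : set X :=
  [set x | exists2 y, f x = Some y & V y].

Lemma phomeo_homeo f : is_homeo f.
Proof. exact/asboolP/phomeoP. Qed.

Lemma preim_open f V : open V -> open (preim f V).
Proof.
by have [oD _ cf _] := phomeo_homeo f; exact: (within_ptotalP oD).1.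
Qed.

(* W' is the direct image of W, which lies in the domain of f; this form is
   symmetric under inversion. *)
Definition is_image (f : pbij X) W W' :=
  [/\ W `<=` pdom f, W' `<=` pran f &
    forall x y, f x = Some y -> W x <-> W' y].

Lemma is_imageV (f : pbij X) W W' :
  is_image f W W' <-> is_image (pbij_inv f) W' W.
Proof.
split=> -[D R fP]; split => //; rewrite ?/pran ?pbij_invK // => x y.
  by move=> /pbij_invP /fP; exact: iff_sym.
by move=> /pbij_invP /fP; exact: iff_sym.
Qed.

Lemma is_image_sub (f : pbij X) W1 W2 V1 V2 :
  is_image f W1 V1 -> is_image f W2 V2 -> W1 `<=` W2 -> V1 `<=` V2.
Proof.
move=> [_ R1 P1] [_ _ P2] W12 y V1y; have /pranP[x fx] := R1 _ V1y.
by apply/(P2 _ _ fx)/W12/(P1 _ _ fx).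
Qed.

Lemma is_image_preim (f : pbij X) V : is_image f (preim f V) (V `&` pran f).
Proof.
split=> [x [y fx _]|y []//|x y fx]; first by apply/pdomP; exists y.
split=> [[z]|[Vy _]]; last by exists y.
by rewrite fx => -[<-] Vy; split=> //; apply/pranP; exists x.
Qed.

Lemma is_image_inj (f : pbij X) W V1 V2 :
  is_image f W V1 -> is_image f W V2 -> V1 = V2.
Proof.
move=> i1 i2; apply/seteqP.
by split; [exact: is_image_sub i1 i2 _ | exact: is_image_sub i2 i1 _].
Qed.

Lemma is_image_dom (f : pbij X) : is_image f (pdom f) (pran f).
Proof.
split=> // x y fx; split=> _; first by apply/pranP; exists x.
by apply/pdomP; exists y.
Qed.

Lemma is_imageM (f g : pbij X) W V :
  is_image (f * g) W V <-> exists2 U, is_image g W U & is_image f U V.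
Proof.
split=> [[D R fgP]|[U [Dg Rg gP] [Df Rf fP]]].
  have Dg x : W x -> exists y z, g x = Some y /\ f y = Some z.
    move=> /D /pdomP[z]; rewrite pbij_mulE.
    by case gx: (g x) => [y|//] fy; exists y, z.
  (* The intermediate set is the direct image of [W] under [g], written as a preimage under the
     inverse of [g]. *)
  exists (preim (pbij_inv g) W).
    split=> [x /Dg[y [z [gx _]]]|y [x /pbij_invP gx _]|x y gx].
    - by apply/pdomP; exists y.
    - by apply/pranP; exists x.
    split=> [Wx|[x' /pbij_invP gx' Wx']]; first by exists x => //; apply/pbij_invP.
    by rewrite (pbij_inj gx gx').
  split=> [y [x /pbij_invP gx /Dg[y' [z [gx' fy]]]]|z /R /pranP[x]|y z fy].
  - by apply/pdomP; exists z; move: gx'; rewrite gx => -[->].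
  - by rewrite pbij_mulE; case: (g x) => [y|//] fy; apply/pranP; exists y.
  split=> [[x /pbij_invP gx Wx]|Vz].
    by apply/(fgP x z) => //; rewrite pbij_mulE gx.
  have /pranP[x] := R _ Vz; rewrite pbij_mulE.
  case gx: (g x) => [y'|//] /= fy'.
  have yy' : y' = y := pbij_inj fy' fy.
  subst y'; exists x; first exact/pbij_invP.
  by apply/(fgP x z) => //; rewrite pbij_mulE gx.
split=> [x Wx|z Vz|x z].
- have /pdomP[y gx] := Dg _ Wx.
  have /pdomP[z fy] : pdom f y by apply/Df/(gP _ _ gx).
  by apply/pdomP; exists z; rewrite pbij_mulE gx.
- have /pranP[y fy] := Rf _ Vz.
  have /pranP[x gx] : pran g y by apply/Rg/(fP _ _ fy).
  by apply/pranP; exists x; rewrite pbij_mulE gx.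
rewrite pbij_mulE; case gx: (g x) => [y|//] /= fy.
exact: iff_trans (gP _ _ gx) (fP _ _ fy).
Qed.

(** The direct image is the preimage under the inverse of [f], which is continuous, so it is
    open. *)
Lemma is_image_ex f (W : opens X) : (W : set X) `<=` pdom f ->
  exists V : opens X, is_image f W V.
Proof.
move=> WD; exists (mkopens (preim_open (phomeo_inv f) (open_opens W))).
apply/is_imageV.
have := is_image_preim (phomeo_inv f) W.
have -> : pran (phomeo_inv f) = pdom f by rewrite /pran pbij_invK.
by have /setIidPl -> := WD.
Qed.

Lemma image_pbij f : exists a : pbij (opens X),
  forall W V : opens X, a W = Some V <-> is_image f W V.
Proof.
apply: pbij_of_rel => [W V V' i1 i2|W W' V /is_imageV i1 /is_imageV i2].
  exact/opens_inj/(is_image_inj i1).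
exact/opens_inj/(is_image_inj i1).
Qed.

Lemma phomeo_open_pdom f : open (pdom f).
Proof. by have [] := phomeo_homeo f. Qed.

Definition dom_opens f : opens X := mkopens (phomeo_open_pdom f).

Lemma dom_opensE f : (dom_opens f : set X) = pdom f.
Proof. by []. Qed.

Lemma is_munn_image f (a : pbij (opens X)) :
  (forall W V : opens X, a W = Some V <-> is_image f W V) -> is_munn a.
Proof.
move=> aP; exists (dom_opens f), (dom_opens (phomeo_inv f)); split.
- apply/seteqP; split=> W; rewrite /pideal/=.
    by move=> /pdomP[V /aP[D _ _]]; apply/leopensP; rewrite dom_opensE.
  move=> /leopensP; rewrite dom_opensE => /is_image_ex[V /aP aW].
  by apply/pdomP; exists V.
- apply/seteqP; split=> V; rewrite /pideal/=.
    by move=> /pranP[W /aP[_ R _]]; apply/leopensP; rewrite dom_opensE.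
  move=> /leopensP; rewrite dom_opensE => /is_image_ex[W iW].
  by apply/pranP; exists W; apply/aP/is_imageV.
move=> W1 W2 V1 V2 /aP i1 /aP i2; apply/idP/idP => /leopensP s; apply/leopensP.
  exact: is_image_sub i1 i2 s.
(* The order is reflected because the inverse of [f] preserves it. *)
move/is_imageV: i1 => i1; move/is_imageV: i2 => i2.
exact: is_image_sub i1 i2 s.
Qed.

Lemma image_munn_ex f : exists a : munn (opens X),
  forall W V : opens X, a W = Some V <-> is_image f W V.
Proof.
have [a aP] := image_pbij f.
by exists (Munn (introT (asboolP _) (is_munn_image aP))).
Qed.

Definition image_munn f : munn (opens X) := sval (cid (image_munn_ex f)).

Lemma image_munnE f (W V : opens X) :
  image_munn f W = Some V <-> is_image f W V.
Proof. exact: (svalP (cid (image_munn_ex f))). Qed.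

Lemma image_munnM : {morph image_munn : f g / f * g}.
Proof.
move=> f g; apply/val_inj/pbij_eqP => W V; rewrite valM pbij_mulE.
split=> [/image_munnE|].
  rewrite valM => /is_imageM[U iU iV].
  (* [is_imageM] yields [U] as a bare set; uniqueness of direct images identifies it with an open
     one. *)
  have [U' iU'] := is_image_ex (let: And3 D _ _ := iU in D).
  have UU' := is_image_inj iU iU'; subst U.
  by have /image_munnE -> := iU'; apply/image_munnE.
case gW: (image_munn g W) => [U|//] /= /image_munnE iV.
move/image_munnE: gW => iU; apply/image_munnE; rewrite valM; apply/is_imageM.
by exists (U : set X).
Qed.

End Image.

(** * Sobriety and injectivity of the action *)

Section Sober.
Context {X : topologicalType} (hX : sober X).

Lemma nbhd_filter_cpf (x : X) : completely_prime_filter (nbhd_filter x).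
Proof.
split=> [|U V [oU Ux] [oV Vx]|U V /leopensP UV [_ Ux]|G [_ [U GU Ux]]].
- by split=> //; exact: openT.
- by split; [exact: open_opens | split].
- by split; [exact: open_opens | exact: UV].
by exists U => //; split=> //; exact: open_opens.
Qed.

(** This is the uniqueness half of sobriety: both points represent the completely prime filter
    [nbhd_filter x]. *)
Lemma sober_point_inj (x y : X) :
  (forall V : set X, open V -> V x <-> V y) -> x = y.
Proof.
move=> xy; have [z [zP zU]] := hX (nbhd_filter_cpf x).
rewrite -(zU _ erefl); apply: zU; apply/seteqP; split=> U [oU Ux].
  by split=> //; apply/(xy _ oU).
by split=> //; apply/(xy _ oU).
Qed.

Lemma image_munn_inj : injective (@image_munn X).
Proof.
suff sub (f g : phomeo X) x y :
    image_munn f = image_munn g -> f x = Some y -> g x = Some y.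
  by move=> f g fg; apply/val_inj/pbij_eqP => x y; split; apply: sub.
move=> fg fx.
have gi (W : opens X) V : is_image f W V -> is_image g W V.
  move=> iV; have [V' iV'] := is_image_ex (let: And3 D _ _ := iV in D).
  have -> := is_image_inj iV iV'; apply/image_munnE; rewrite -fg.
  exact/image_munnE.
have iD : is_image g (pdom f) (pran f).
  exact: gi (dom_opens f) _ (is_image_dom f).
have Dx : pdom f x by apply/pdomP; exists y.
have /pdomP[y' gx] : pdom g x by have [+ _ _] := iD; apply.
suff -> : y = y' by [].
(* Both [f] and [g] send [preim f V] to [V]&[pran f], and [y] and [y'] both lie in [pran f], so
   [V y] and [V y'] are each equivalent to [preim f V x]. *)
apply: sober_point_inj => V oV.
have [_ _ /(_ _ _ fx)] := is_image_preim f V.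
have [_ _ /(_ _ _ gx)] := gi (mkopens (preim_open f oV)) _ (is_image_preim f V).
have [_ _ /(_ _ _ gx)] := iD.
have : pran f y by apply/pranP; exists x.
rewrite /=; tauto.
Qed.

(** * The point map of an isomorphism between principal ideals *)

Section PointMap.
Variables (a : pbij (opens X)) (e h : opens X).
Hypotheses (Da : pdom a = pideal e) (Ra : pran a = pideal h).
Hypothesis a_mono : forall x y x' y', a x = Some x' -> a y = Some y' ->
  (x <= y)%O = (x' <= y')%O.

(** The condition is symmetric under inverting [a] and exchanging [e] and [h], so results on [a]
    also serve the inverse map. *)
Definition induces (x y : X) := [/\ (e : set X) x, (h : set X) y &
  forall W V : opens X, a W = Some V -> (W : set X) x <-> (V : set X) y].

Lemma munn_fun W : (W <= e)%O -> exists V, a W = Some V.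
Proof. by move=> We; apply/pdomP; rewrite Da. Qed.

Lemma munn_preim V : (V <= h)%O -> exists W, a W = Some V.
Proof. by move=> Vh; apply/pranP; rewrite Ra. Qed.

Lemma munn_dom_le W V : a W = Some V -> (W <= e)%O.
Proof.
by move=> aW; have : pdom a W by [apply/pdomP; exists V]; rewrite Da.
Qed.

Lemma munn_ran_le W V : a W = Some V -> (V <= h)%O.
Proof.
by move=> aW; have : pran a V by [apply/pranP; exists W]; rewrite Ra.
Qed.

Lemma munn_top : a e = Some h.
Proof.
have [V aV] := munn_fun (lexx e); have [W aW] := munn_preim (lexx h).
rewrite aV; congr Some; apply/le_anti/andP; split; first exact: munn_ran_le aV.
by rewrite -(a_mono aW aV) (munn_dom_le aW).
Qed.

(** The values of [a] all lie below [h]; closing upwards supplies the remaining members of a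
    filter. *)
Definition pushed_filter (x : X) : set (opens X) :=
  [set V | exists W W', [/\ a W = Some W', (W : set X) x & (W' <= V)%O]].

Lemma pushed_filter_cpf x : (e : set X) x ->
  completely_prime_filter (pushed_filter x).
Proof.
move=> ex; split.
- by exists e, h; split; [exact: munn_top | | exact: lex1].
- move=> U V [W1 [W1' [a1 x1 l1]]] [W2 [W2' [a2 x2 l2]]].
  have [W' aW] := munn_fun (le_trans (leIl W1 W2) (munn_dom_le a1)).
  exists (W1 `&` W2)%O, W'; split=> //; rewrite lexI.
  rewrite (le_trans _ l1) -?(a_mono aW a1) ?leIl//.
  by rewrite (le_trans _ l2) -?(a_mono aW a2) ?leIr.
- move=> U V UV [W [W' [aW Wx W'U]]].
  by exists W, W'; split=> //; exact: le_trans UV.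
(* The union Z of the opens sent into members of G is all of W, because its
   image contains every W' `&` U with U in G. *)
move=> G [W [W' [aW Wx /leopensP W'G]]].
pose H : set (opens X) :=
  [set Y | (Y <= W)%O /\
    exists2 U, G U & exists2 Y', a Y = Some Y' & (Y' <= U)%O].
pose Z := opens_bigcup H.
have ZW : (Z <= W)%O by apply/leopensP => z [Y [/leopensP YW _]] /YW.
have [Z' aZ] := munn_fun (le_trans ZW (munn_dom_le aW)).
have /leopensP/(_ x Wx)[Y [_ [U GU [Y' aY Y'U]]] Yx] : (W <= Z)%O.
  rewrite (a_mono aW aZ); apply/leopensP => y W'y.
  have [U GU Uy] := W'G _ W'y.
  have [Y aY] := munn_preim (le_trans (leIl W' U) (munn_ran_le aW)).
  have HY : H Y.
    split; first by rewrite (a_mono aY aW) leIl.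
    by exists U => //; exists (W' `&` U)%O => //; exact: leIr.
  have YZ : (Y <= Z)%O by apply/leopensP => z Yz; exists Y.
  by move: YZ; rewrite (a_mono aY aZ) => /leopensP; apply; split.
by exists U => //; exists Y, Y'.
Qed.

Lemma induces_ex x : (e : set X) x -> exists y, induces x y.
Proof.
move=> ex; have [y [yP _]] := hX (pushed_filter_cpf ex).
have yE V : pushed_filter x V <-> (V : set X) y.
  by rewrite yP; split=> [[]//|Vy]; split=> //; exact: open_opens.
exists y; split=> //.
  by apply/yE; exists e, h; split=> //; exact: munn_top.
move=> W V aW; split=> [Wx|/yE[W0 [V0 [aW0 W0x]]]].
  by apply/yE; exists W, V.
(* [a] reflects the order, so [V0 <= V] gives [W0 <= W], and [x] lies in [W0]. *)
by rewrite -(a_mono aW0 aW) => /leopensP; apply.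
Qed.

Lemma induces_fun x y y' : induces x y -> induces x y' -> y = y'.
Proof.
move=> [_ hy yP] [_ hy' yP']; apply: sober_point_inj => V oV.
(* Only opens below [h] are values of [a], so [V] is tested through its trace on [h], which contains
   both points. *)
have [W aW] := munn_preim (leIr h (mkopens oV)).
have := yP _ _ aW; have := yP' _ _ aW.
have E z : ((mkopens oV `&` h)%O : set X) z <-> V z /\ (h : set X) z by [].
rewrite !E; tauto.
Qed.

Lemma induced_pdom (f : pbij X) :
  (forall x y, f x = Some y <-> induces x y) -> pdom f = e.
Proof.
move=> fP; apply/seteqP; split=> x.
  by move=> /pdomP[y /fP[]].
by move=> /induces_ex[y /fP fx]; apply/pdomP; exists y.
Qed.

(** The preimage of [V] under [f] is the open [W] that [a] sends to the trace of [V] on [h]. *)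
Lemma induced_continuous (f : pbij X) :
  (forall x y, f x = Some y <-> induces x y) ->
  open (pdom f) /\ {within pdom f, continuous (ptotal f)}.
Proof.
move=> fP; have oD : open (pdom f).
  by rewrite (induced_pdom fP); exact: open_opens.
split=> //; apply/within_ptotalP => // V oV.
have [W aW] := munn_preim (leIr h (mkopens oV)).
have -> : [set x | exists2 y, f x = Some y & V y] = W; last exact: open_opens.
apply/seteqP; split=> x.
  by move=> [y /fP[_ hy /(_ _ _ aW) WP] Vy]; apply/WP; split.
have /leopensP We := munn_dom_le aW.
move=> Wx; have [y ixy] := induces_ex (We _ Wx).
exists y; first exact/fP.
by have [_ _ /(_ _ _ aW) [/(_ Wx)[]]] := ixy.
Qed.

End PointMap.

(** * Surjectivity of the action *)

Lemma inducesV (a : pbij (opens X)) e h x y :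
  induces (pbij_inv a) h e y x <-> induces a e h x y.
Proof.
split=> -[? ? P]; split=> // W V.
  by rewrite -pbij_invP => /P WV; exact: iff_sym.
by rewrite pbij_invP => /P WV; exact: iff_sym.
Qed.

Lemma image_munn_surj (a : munn (opens X)) : exists f, image_munn f = a.
Proof.
have /asboolP[e [h [Da Ra a_mono]]] := munnP a.
have RaV : pran (pbij_inv a) = pideal e by rewrite /pran pbij_invK.
have aV_mono x y x' y' : pbij_inv a x = Some x' -> pbij_inv a y = Some y' ->
    (x <= y)%O = (x' <= y')%O.
  by move=> /pbij_invP ax /pbij_invP ay; exact/esym/a_mono.
have [f fP] : exists f : pbij X, forall x y, f x = Some y <-> induces a e h x y.
  apply: pbij_of_rel => [x y y'|x x' y /inducesV ix /inducesV ix'].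
    exact: induces_fun.
  exact: (@induces_fun (pbij_inv a)) ix ix'.
have fVP y x : pbij_inv f y = Some x <-> induces (pbij_inv a) h e y x.
  rewrite inducesV -fP; exact/pbij_invP.
have [oD cD] := induced_continuous Da Ra a_mono fP.
have [oR cR] := induced_continuous Ra RaV aV_mono fVP.
have Hf : is_homeo f by [].
pose F := PHomeo (introT (asboolP _) Hf).
have Df : pdom F = e := induced_pdom Da Ra a_mono fP.
have Rf : pran F = h := induced_pdom Ra RaV aV_mono fVP.
have aF W V : a W = Some V -> is_image F W V.
  move=> aW; split.
  - by rewrite Df; exact/leopensP/(munn_dom_le Da aW).
  - by rewrite Rf; exact/leopensP/(munn_ran_le Ra aW).
  by move=> x y /fP[_ _]; apply.
exists F; apply/val_inj/pbij_eqP => W V.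
split=> [/image_munnE iV|/aF /image_munnE//].
(* For the converse inclusion of graphs it is enough that [a] is defined at [W], because direct
   images are unique. *)
have [V' aW] : exists V', a W = Some V'.
  by apply: (munn_fun Da); apply/leopensP; rewrite -Df; case: iV.
by rewrite aW; congr Some; exact/opens_inj/(is_image_inj (aF _ _ aW)).
Qed.

End Sober.

Theorem propositionE (X : topologicalType) (hX : sober X) :
  exists theta : {multiplicative munn (opens X) -> phomeo X}, bijective theta.
Proof.
(* A section of the injective morphism [image_munn] is its two-sided inverse, and it inherits
   multiplicativity. *)
have /choice[theta thetaK] := image_munn_surj hX.
have imageK : cancel (@image_munn X) theta.
  by move=> f; apply: (image_munn_inj hX); exact: thetaK.
have thetaM : {morph theta : a b / a * b}.
  by move=> a b; apply: (image_munn_inj hX); rewrite image_munnM !thetaK.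
pose m := isMultiplicative.Build _ _ theta thetaM.
pose t : {multiplicative munn (opens X) -> phomeo X} := HB.pack theta m.
by exists t; exists (@image_munn X).
Qed.
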